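(* Assume that $\bar{\mathcal P}$ is Archimedean. For $d\in\mathbb{N}$ consider the degree-$2d$ program: find a positive definite symmetric $Y\in\mathbb{R}^{n\times n}$ and $S\in\mathbb{R}^{m\times n}$ such that $$\begin{bmatrix}Y&AY+BS\\(AY+BS)^T&Y\end{bmatrix}\in\Sigma^{2n}[\bar{\mathcal P}]_{\le2d}.$$ This program recovers a quadratically stabilizing controller, if one exists, as $d\to\infty$. That is: for every $d$, any feasible solution $(Y,S)$ satisfies $$\begin{bmatrix}Y&AY+BS\\(AY+BS)^T&Y\end{bmatrix}\succ0\quad\text{for all }(A,B)\in\mathcal P, \qquad(\ast)$$ so that $K=SY^{-1}$ quadratically stabilizes all plants in $\mathcal P$; and if there exist a positive definite symmetric $Y$ and $S\in\mathbb{R}^{m\times n}$ satisfying $(\ast)$, then the degree-$2d$ program is feasible for all sufficiently large $d$.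
   Context: Data: integers $n,m\ge1$, $T\ge2$, a noise bound $\epsilon\ge0$, and recorded vectors $\hat x_t\in\mathbb{R}^n$ ($t=1,\dots,T$), $u_t\in\mathbb{R}^m$ ($t=1,\dots,T-1$). For $A\in\mathbb{R}^{n\times n}$, $B\in\mathbb{R}^{n\times m}$ put $h^0_t=\hat x_{t+1}-A\hat x_t-Bu_t$ for $t=1,\dots,T-1$. The consistency set $\bar{\mathcal P}\subset\mathbb{R}^{n\times n}\times\mathbb{R}^{n\times m}\times\mathbb{R}^{n\times T}$ is the set of all $(A,B,\Delta x)$, with $\Delta x=(\Delta x_1,\dots,\Delta x_T)$, such that $0=-\Delta x_{t+1}+A\Delta x_t+h^0_t$ for $t=1,\dots,T-1$ and $\|\Delta x_t\|_\infty\le\epsilon$ for $t=1,\dots,T$. It is regarded as described by the polynomial equalities $(-\Delta x_{t+1}+A\Delta x_t+h^0_t)_i=0$ and the inequalities $\epsilon-\Delta x_{ti}\ge0$, $\epsilon+\Delta x_{ti}\ge0$, where $\Delta x_{ti}$ is the $i$-th entry of $\Delta x_t$. The set $\mathcal P$ of consistent plants is the projection of $\bar{\mathcal P}$ onto the $(A,B)$ coordinates. A controller $K$ quadratically stabilizes all plants in $\mathcal P$ if $K=SY^{-1}$ for some $(Y,S)$, common to all plants, with $Y\succ0$ and $(\ast)$. A symmetric $s\times s$ polynomial matrix $P(x)$ is a sum-of-squares (SOS) matrix if $P(x)=(w(x)\otimes I_s)^TG(w(x)\otimes I_s)$ for some vector $w(x)$ of $q$ polynomials and some positive semidefinite $G\in\mathbb{R}^{qs\times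 qs}$. For a set $\mathbb{K}$ described by scalar polynomial inequalities $g_i(x)\ge0$ and equalities $h_j(x)=0$, $\Sigma^s[\mathbb{K}]$ is the set of symmetric $s\times s$ polynomial matrices of the form $\sigma_0+\sum_i\sigma_ig_i+\sum_j\phi_jh_j+\varepsilon I_s$ with $\sigma_0,\sigma_i$ SOS matrices of size $s$, $\phi_j$ symmetric $s\times s$ polynomial matrices, and some $\varepsilon>0$; $\Sigma^s[\mathbb{K}]_{\le2d}$ is the subset for which such a representation exists with $\sigma_0$, every $\sigma_ig_i$ and every $\phi_jh_j$ of degree at most $2d$. $\mathbb{K}$ is Archimedean if there is $R>0$ such that $R-\|x\|_2^2=\sigma_0+\sum_i\sigma_ig_i+\sum_j\phi_jh_j$ for some sum-of-squares polynomials $\sigma_0,\sigma_i$ and polynomials $\phi_j$. Here $x=(A,B,\Delta x)$. *)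

(* Defs.v *)
From HB Require Import structures.
From mathcomp Require Import all_boot all_order all_algebra.
From mathcomp Require Import reals.
From mathcomp Require Import mpoly.

Set Implicit Arguments.
Unset Strict Implicit.
Unset Printing Implicit Defensive.

Import Order.TTheory GRing.Theory Num.Theory.
Local Open Scope ring_scope.

Section Definiteness.
Variable R : realType.

Definition posdef s (M : 'M[R]_s) : Prop :=
  M^T = M /\ forall v : 'cV[R]_s, v != 0 -> 0 < (v^T *m M *m v) 0 0.

Definition psd s (M : 'M[R]_s) : Prop :=
  M^T = M /\ forall v : 'cV[R]_s, 0 <= (v^T *m M *m v) 0 0.

Definition norm_inf s (v : 'cV[R]_s) : R := \big[Num.max/0]_i `|v i 0|.

End Definiteness.

(* The Kronecker product of the column [w] with the identity matrix of size
   [s].  Its rows are indexed by pairs (k, i) in the row-major order of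
   [mxvec_index]; the entry at row (k, i) and column j is [w_k] if i = j and 0
   otherwise (see [kron_idE]). *)
Definition kron_id (V : pzSemiRingType) q s (w : 'cV[V]_q) : 'M[V]_(q * s, s) :=
  \matrix_(r, j)
    let ki := enum_val (cast_ord (esym (mxvec_cast q s)) r) in
    w ki.1 0 *+ (ki.2 == j).

Lemma kron_idE (V : pzSemiRingType) q s (w : 'cV[V]_q) k i (j : 'I_s) :
  kron_id s w (mxvec_index k i) j = w k 0 *+ (i == j).
Proof. by rewrite mxE /mxvec_index cast_ordK enum_rankK. Qed.

Section SumsOfSquares.
Variables (R : realType) (N : nat).

Definition cst_mx p q (M : 'M[R]_(p, q)) : 'M[{mpoly R[N]}]_(p, q) :=
  map_mx (@mpolyC N R) M.

Definition sos (p : {mpoly R[N]}) : Prop :=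
  exists (q : nat) (f : 'I_q -> {mpoly R[N]}), p = \sum_k f k ^+ 2.

Definition sos_mx s (P : 'M[{mpoly R[N]}]_s) : Prop :=
  exists (q : nat) (w : 'cV[{mpoly R[N]}]_q) (G : 'M[R]_(q * s)),
    psd G /\ P = (kron_id s w)^T *m cst_mx G *m kron_id s w.

(* [msize p] is the total degree of [p] plus one, and [msize 0 = 0]. *)
Definition mxdeg_le (k : nat) s (P : 'M[{mpoly R[N]}]_s) : Prop :=
  forall i j, (msize (P i j) <= k.+1)%N.

(* The set described by g_i >= 0 and h_j = 0 enters only through the two
   families of polynomials describing it. *)
Variables (I J : finType) (g : I -> {mpoly R[N]}) (h : J -> {mpoly R[N]}).

Definition semialg (x : 'I_N -> R) : Prop :=
  (forall i, 0 <= (g i).@[x]) /\ (forall j, (h j).@[x] = 0).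

Definition archimedean : Prop :=
  exists2 r : R, 0 < r &
  exists (sigma0 : {mpoly R[N]}) (sigma : I -> {mpoly R[N]})
         (phi : J -> {mpoly R[N]}),
    [/\ sos sigma0, forall i, sos (sigma i) &
        r%:MP - \sum_(k < N) 'X_k ^+ 2 =
          sigma0 + \sum_i sigma i * g i + \sum_j phi j * h j].

(* The truncation of degree at most 2 d of the set of s x s polynomial
   matrices certified positive definite on the set described by g and h. *)
Definition Sigma_le (d s : nat) (P : 'M[{mpoly R[N]}]_s) : Prop :=
  exists (sigma0 : 'M[{mpoly R[N]}]_s) (sigma : I -> 'M[{mpoly R[N]}]_s)
         (phi : J -> 'M[{mpoly R[N]}]_s) (e : R),
    [/\ [/\ sos_mx sigma0, forall i, sos_mx (sigma i),
            forall j, (phi j)^T = phi j & 0 < e],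
        [/\ mxdeg_le (2 * d) sigma0,
            forall i, mxdeg_le (2 * d) (g i *: sigma i) &
            forall j, mxdeg_le (2 * d) (h j *: phi j)] &
        P = sigma0 + \sum_i g i *: sigma i + \sum_j h j *: phi j
            + cst_mx (e%:M)].

End SumsOfSquares.

(* A trajectory of length T is stored as a matrix with T columns, and one of
   length T - 1 as a matrix with T.-1 columns.  A transition index [t] in
   'I_T.-1 has a source time [t] and a target time [t + 1] in 'I_T. *)
Definition src T (t : 'I_T.-1) : 'I_T := widen_ord (leq_pred T) t.

Lemma tgt_subproof T (t : 'I_T.-1) : (t.+1 < T)%N.
Proof. by rewrite -ltn_predRL. Qed.

Definition tgt T (t : 'I_T.-1) : 'I_T := Ordinal (tgt_subproof t).

(* These expressions are stated over an arbitrary ring because they are used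
   both over the reals and over polynomials in (A, B, Dx). *)
Section Dynamics.
Variables (V : pzRingType) (n m T : nat).

Definition h0 (X : 'M[V]_(n, T)) (U : 'M[V]_(m, T.-1))
    (A : 'M[V]_n) (B : 'M[V]_(n, m)) (t : 'I_T.-1) : 'cV[V]_n :=
  col (tgt t) X - A *m col (src t) X - B *m col t U.

Definition residual (X : 'M[V]_(n, T)) (U : 'M[V]_(m, T.-1))
    (A : 'M[V]_n) (B : 'M[V]_(n, m)) (Dx : 'M[V]_(n, T)) (t : 'I_T.-1) :
    'cV[V]_n :=
  - col (tgt t) Dx + A *m col (src t) Dx + h0 X U A B t.

Definition stab_mx (Y : 'M[V]_n) (S : 'M[V]_(m, n))
    (A : 'M[V]_n) (B : 'M[V]_(n, m)) : 'M[V]_(n + n) :=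
  block_mx Y (A *m Y + B *m S) (A *m Y + B *m S)^T Y.

End Dynamics.

Section Consistency.
Variables (R : realType) (n m T : nat).
Variables (eps : R) (X : 'M[R]_(n, T)) (U : 'M[R]_(m, T.-1)).

Definition Pbar (A : 'M[R]_n) (B : 'M[R]_(n, m)) (Dx : 'M[R]_(n, T)) : Prop :=
  (forall t : 'I_T.-1, 0 = residual X U A B Dx t) /\
  (forall t : 'I_T, norm_inf (col t Dx) <= eps).

Definition plants (A : 'M[R]_n) (B : 'M[R]_(n, m)) : Prop :=
  exists Dx : 'M[R]_(n, T), Pbar A B Dx.

Definition stab_cert (Y : 'M[R]_n) (S : 'M[R]_(m, n)) : Prop :=
  forall A B, plants A B -> posdef (stab_mx Y S A B).

Definition quad_stabilizes (K : 'M[R]_(m, n)) : Prop :=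
  exists (Y : 'M[R]_n) (S : 'M[R]_(m, n)),
    [/\ posdef Y, stab_cert Y S & K = S *m invmx Y].

(* The entries of A, of B and of Dx, in this order, are the indeterminates. *)
Definition nvars : nat := n * n + n * m + n * T.
Local Notation poly := {mpoly R[nvars]}.

Definition varA : 'M[poly]_n :=
  \matrix_(i, j) 'X_(lshift (n * T) (lshift (n * m) (mxvec_index i j))).
Definition varB : 'M[poly]_(n, m) :=
  \matrix_(i, j) 'X_(lshift (n * T) (rshift (n * n) (mxvec_index i j))).
Definition varDx : 'M[poly]_(n, T) :=
  \matrix_(i, t) 'X_(rshift (n * n + n * m) (mxvec_index i t)).

Definition point (A : 'M[R]_n) (B : 'M[R]_(n, m)) (Dx : 'M[R]_(n, T)) :
    'I_nvars -> R :=
  row_mx (row_mx (mxvec A) (mxvec B)) (mxvec Dx) 0.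

Definition ineqs (b : bool * 'I_n * 'I_T) : poly :=
  let: (s, i, t) := b in
  if s then eps%:MP - varDx i t else eps%:MP + varDx i t.

Definition eqs (e : 'I_n * 'I_T.-1) : poly :=
  residual (cst_mx nvars X) (cst_mx nvars U) varA varB varDx e.2 e.1 0.

Definition Pbar_archimedean : Prop := archimedean ineqs eqs.

Definition feasible (d : nat) (Y : 'M[R]_n) (S : 'M[R]_(m, n)) : Prop :=
  posdef Y /\
  Sigma_le ineqs eqs d (stab_mx (cst_mx nvars Y) (cst_mx nvars S) varA varB).

Lemma meval_varA A B Dx : map_mx (meval (point A B Dx)) varA = A.
Proof.
by apply/matrixP=> i j; rewrite !mxE mevalXU /point !row_mxEl mxvecE.
Qed.

Lemma meval_varB A B Dx : map_mx (meval (point A B Dx)) varB = B.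
Proof.
by apply/matrixP=> i j; rewrite !mxE mevalXU /point row_mxEl row_mxEr mxvecE.
Qed.

Lemma meval_varDx A B Dx : map_mx (meval (point A B Dx)) varDx = Dx.
Proof.
by apply/matrixP=> i j; rewrite !mxE mevalXU /point row_mxEr mxvecE.
Qed.

Lemma meval_cst_mx p q (x : 'I_nvars -> R) (M : 'M[R]_(p, q)) :
  map_mx (meval x) (cst_mx nvars M) = M.
Proof. by apply/matrixP=> i j; rewrite !mxE mevalC. Qed.

Lemma meval_eqs A B Dx e :
  (eqs e).@[point A B Dx] = residual X U A B Dx e.2 e.1 0.
Proof.
have -> : (eqs e).@[point A B Dx] =
    map_mx (meval (point A B Dx))
      (residual (cst_mx nvars X) (cst_mx nvars U) varA varB varDx e.2) e.1 0.
  by rewrite mxE.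
rewrite /residual /h0 !(map_mxD, map_mxN, map_mxM) !map_col.
by rewrite meval_varA meval_varB meval_varDx !meval_cst_mx.
Qed.

Lemma norm_inf_le s (v : 'cV[R]_s) :
  0 <= eps -> (norm_inf v <= eps) <-> (forall i, `|v i 0| <= eps).
Proof.
move=> eps0; split=> [le_eps i|le_eps]; last first.
  rewrite /norm_inf; elim/big_ind: _ => // x y xe ye.
  by rewrite ge_max xe ye.
by apply: le_trans le_eps; rewrite /norm_inf (bigD1 i) //= le_max lexx.
Qed.

Lemma PbarE A B Dx : 0 <= eps ->
  Pbar A B Dx <-> semialg ineqs eqs (point A B Dx).
Proof.
move=> eps0.
have evDx i t : (varDx i t).@[point A B Dx] = Dx i t.
  by have /matrixP/(_ i t) := meval_varDx A B Dx; rewrite [LHS]mxE.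
split=> [[res nrm]|[ge0 eq0]]; split.
- move=> [[s i] t]; move/(norm_inf_le _ eps0): (nrm t) => /(_ i).
  rewrite mxE ler_norml => /andP[lo hi].
  case: s => /=; rewrite ?mevalB ?mevalD mevalC evDx ?subr_ge0 //.
  by rewrite -lerBlDl sub0r.
- by move=> [i t]; rewrite meval_eqs -res mxE.
- by move=> t; apply/colP=> i; rewrite -(meval_eqs A B Dx (i, t)) eq0 mxE.
- move=> t; apply/(norm_inf_le _ eps0) => i; rewrite mxE ler_norml.
  have := ge0 (true, i, t); have := ge0 (false, i, t).
  rewrite /= mevalB mevalD mevalC evDx subr_ge0 => lo ->.
  by rewrite andbT -subr_ge0 opprK addrC.
Qed.

End Consistency.

(* Main.v *)
(* Sufficiency of a certificate follows by evaluating it at a point.  The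
   converse is Putinar's theorem for matrix polynomials.  Let K be the
   quadratic module of matrices sigma0 + sum g_i sigma_i + sum h_j phi_j, which
   is stable under multiplication by squares of scalar polynomials; by the
   Archimedean hypothesis the identity is an order unit.  If -1 is not in K, a
   maximal quadratic module C containing K but not -1 is total, and
   L P = sup {r | P - r in C} is a linear form with L (p P) = p(x) (L P) for
   some point x; then x lies in the semialgebraic set and L P = L (P(x)), which
   is positive when P(x) is positive definite.  Applied to K - (sums of squares) P
   for P positive definite on the set, this gives t P in 1 + K with t a sum of
   squares, and an Archimedean descent turns it into P in e + K with e > 0. *)

Require Import Defs.
From mathcomp Require Import all_boot all_order all_algebra.
From mathcomp Require Import boolp classical_sets reals.
From mathcomp Require Import mpoly ring lra.

Import Order.TTheory GRing.Theory Num.Theory.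
Local Open Scope ring_scope.

Ltac mx_ring :=
  apply/matrixP => ? ?; rewrite !mxE; try case: eqP => _;
  rewrite ?mulr1n ?mulr0n; ring.

(** * Quadratic modules of matrix polynomials *)

Section QuadraticCones.
Variables (R : realType) (N s : nat).
Local Notation poly := {mpoly R[N]}.
Local Notation mat := 'M[{mpoly R[N]}]_s.

Implicit Types (p : poly) (v w : mat) (r : R).

Definition quadratic_cone (C : set mat) : Prop :=
  (forall v w, C v -> C w -> C (v + w)) /\ (forall p v, C v -> C (p ^+ 2 *: v)).

Definition order_unit (C : set mat) : Prop :=
  forall v, exists r, C (r%:MP%:M - v).

Lemma sos_square p : sos (p ^+ 2).
Proof. by exists 1, (fun=> p); rewrite big_ord1. Qed.

Lemma sosD p q : sos p -> sos q -> sos (p + q).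
Proof.
move=> [a [f ->]] [b [f' ->]].
exists (a + b)%N, (fun k => match split k with inl i => f i | inr j => f' j end).
rewrite big_split_ord /=; congr (_ + _); apply: eq_bigr => i _.
  by have := @unsplitK a b (inl i); rewrite /= => ->.
by have := @unsplitK a b (inr i); rewrite /= => ->.
Qed.

Lemma sos_squareM p q : sos q -> sos (p ^+ 2 * q).
Proof.
move=> [a [f ->]]; exists a, (fun k => p * f k).
by rewrite mulr_sumr; apply: eq_bigr => k _; rewrite exprMn.
Qed.

Section Theory.
Variable C : set mat.
Hypothesis qC : quadratic_cone C.

Lemma qconeD v w : C v -> C w -> C (v + w). Proof. exact: qC.1. Qed.

Lemma qconeX p v : C v -> C (p ^+ 2 *: v). Proof. exact: qC.2. Qed.

Lemma qcone0 v : C v -> C 0.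
Proof. by move=> /(qconeX 0); rewrite expr0n scale0r. Qed.

Lemma qconeS p v : sos p -> C v -> C (p *: v).
Proof.
move=> [a [f ->]] Cv; rewrite scaler_suml.
elim/big_ind: _ => [|x y|i _]; [exact: qcone0 Cv|exact: qconeD|exact: qconeX].
Qed.

Lemma qconeZ r v : 0 <= r -> C v -> C (r%:MP *: v).
Proof.
move=> r0 Cv; rewrite -(sqr_sqrtr r0) rmorphXn /=; exact: qconeX.
Qed.

End Theory.

(** * Maximal quadratic modules *)

Lemma maximal_qcone (K : set mat) : quadratic_cone K -> ~ K (- 1%:M) ->
  exists C : set mat, [/\ quadratic_cone C, K `<=` C, ~ C (- 1%:M) &
    forall D, quadratic_cone D -> C `<=` D -> ~ D (- 1%:M) -> D `<=` C]%classic.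
Proof.
move=> qK K1.
(* Zorn's lemma also covers the empty chain, whose union is empty. Joining [K] to [D] makes the
   empty set admissible. *)
pose P (D : set mat) := quadratic_cone (D `|` K)%classic /\ ~ D (- 1%:M).
have [|A [[qA A1] maxA]] := @Zorn_bigcup mat P.
  move=> F FP tot; split; last by move=> [D FD]; case: (FP _ FD).
  split=> [v w|p v].
    move=> [[D FD Dv]|Kv] [[E FE Ew]|Kw].
    - have [DE|ED] := tot _ _ FD FE.
        have [|] := (FP _ FE).1.1 v w (or_introl (DE _ Dv)) (or_introl Ew).
          by left; exists E.
        by right.
      have [|] := (FP _ FD).1.1 v w (or_introl Dv) (or_introl (ED _ Ew)).
        by left; exists D.
      by right.
    - have [|] := (FP _ FD).1.1 v w (or_introl Dv) (or_intror Kw).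
        by left; exists D.
      by right.
    - have [|] := (FP _ FE).1.1 v w (or_intror Kv) (or_introl Ew).
        by left; exists E.
      by right.
    - by right; apply: qK.1.
  move=> [[D FD Dv]|Kv]; last by right; apply: qK.2.
  by have [|] := (FP _ FD).1.2 p v (or_introl Dv); [left; exists D|right].
exists (A `|` K)%classic; split => //; first by case.
move=> D qD AD D1 v Dv; apply: contrapT => nv.
apply: (maxA D).
  split; first by move=> x Ax; apply: AD; left.
  by move=> DA; apply: nv; left; apply: DA.
split=> //; suff -> : (D `|` K = D)%classic by [].
apply/seteqP; split=> x; last by left.
by case=> // Kx; apply: AD; right.
Qed.

(** The quadratic module generated by [C] and [v]. Sums of squares, rather than squares, as
    coefficients of [v] keep it closed under addition. *)
Definition qcone_add (C : set mat) (v : mat) : set mat :=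
  [set x | exists2 c, C c & exists2 p, sos p & x = c + p *: v]%classic.

Lemma qcone_addP C v : quadratic_cone C -> quadratic_cone (qcone_add C v).
Proof.
move=> qC; split=> [x y|q x].
  move=> [c Cc [p sp ->]] [c' Cc' [p' sp' ->]].
  exists (c + c'); first exact: qC.1.
  by exists (p + p'); [exact: sosD|rewrite scalerDl addrACA].
move=> [c Cc [p sp ->]]; exists (q ^+ 2 *: c); first exact: qC.2.
by exists (q ^+ 2 * p); [exact: sos_squareM|rewrite scalerDr scalerA].
Qed.

Lemma qcone_add_sub C v : (C `<=` qcone_add C v)%classic.
Proof.
move=> c Cc; exists c => //; exists (0 ^+ 2); first exact: sos_square.
by rewrite expr0n scale0r addr0.
Qed.

Lemma qcone_add_mem C v : C 0 -> qcone_add C v v.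
Proof.
move=> C0; exists 0 => //; exists (1 ^+ 2); first exact: sos_square.
by rewrite expr1n scale1r add0r.
Qed.

(* If neither v nor -v can be added to C, then -1 = c1 + p1 v = c2 - p2 v with
   p1, p2 sums of squares; eliminating v gives -p1 1 in C, and since v is
   bounded by a multiple of 1 also p1 v in C, whence -1 in C. *)
Lemma maximal_total (C : set mat) : quadratic_cone C -> order_unit C -> C 1%:M ->
  ~ C (- 1%:M) ->
  (forall D, quadratic_cone D -> C `<=` D -> ~ D (- 1%:M) -> D `<=` C)%classic ->
  forall v, C v \/ C (- v).
Proof.
move=> qC uC C1 nC maxC v.
have C0 := qcone0 _ qC _ C1.
have step w : ~ C w -> exists2 c, C c & exists2 p, sos p & - 1%:M = c + p *: w.
  move=> nw; apply: contrapT => n1; apply: nw.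
  apply: (maxC (qcone_add C w)) => //; first exact: qcone_addP.
    exact: qcone_add_sub.
  exact: qcone_add_mem.
have [|nv] := pselect (C v); first by left.
have [|nv'] := pselect (C (- v)); first by right.
have [c1 Cc1 [p1 sp1 e1]] := step _ nv.
have [c2 Cc2 [p2 sp2 e2]] := step _ nv'.
exfalso; apply: nC.
have Cp1 : C (- p1%:M).
  have -> : - p1%:M = p2 *: c1 + p1 *: c2 + p2 *: 1%:M.
    have : p2 *: (- 1%:M) + p1 *: (- 1%:M) = p2 *: c1 + p1 *: c2.
      by rewrite {1}e1 e2; mx_ring.
    by move=> <-; mx_ring.
  by do !(apply: (qconeD _ qC)); apply: qconeS.
have [r Cr] := uC (- v).
rewrite e1; apply: (qconeD _ qC) => //.
(* [|r|] replaces [r] because the coefficient of [- p1%:M] has to be nonnegative. *)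
have -> : p1 *: v = p1 *: (`|r|%:MP%:M + v) + `|r|%:MP *: (- p1%:M) by mx_ring.
apply: (qconeD _ qC); last by apply: qconeZ.
apply: qconeS => //.
have -> : `|r|%:MP%:M + v = (r%:MP%:M - - v) + (`|r| - r)%:MP *: 1%:M.
  by mx_ring.
apply: (qconeD _ qC) => //; apply: qconeZ => //.
by rewrite subr_ge0 ler_norm.
Qed.


(** * The linear form of a total quadratic module *)

Section State.
Variable C : set mat.
Hypotheses (qC : quadratic_cone C) (uC : order_unit C) (C1 : C 1%:M)
  (nC : ~ C (- 1%:M)) (tC : forall v, C v \/ C (- v)).

(** A negative scalar in [C] could be rescaled to -1. This turns membership of scalars into real
    inequalities. *)
Lemma qcone_scalar r : C (r%:MP%:M) <-> 0 <= r.
Proof.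
split=> [Cr|r0]; last first.
  have -> : r%:MP%:M = r%:MP *: 1%:M :> mat by mx_ring.
  exact: qconeZ.
rewrite leNgt; apply/negP => r0; apply: nC.
have -> : - 1%:M = (- r^-1)%:MP *: r%:MP%:M :> mat.
  rewrite -mul_scalar_mx -scalar_mxM -mpolyCM mulNr mulVf ?lt_eqF //.
  by rewrite mpolyCN mpolyC1 raddfN.
by apply: qconeZ => //; rewrite oppr_ge0 invr_le0 ltW.
Qed.

Definition state v : R := sup [set r | C (v - r%:MP%:M)]%classic.

Lemma state_has_sup v : has_sup [set r | C (v - r%:MP%:M)]%classic.
Proof.
split.
  have [r Cr] := uC (- v); exists (- r) => /=.
  by have -> : v - (- r)%:MP%:M = r%:MP%:M - - v by mx_ring.
have [r0 Cr0] := uC v; exists r0 => r /= Cr.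
rewrite -subr_ge0; apply/qcone_scalar.
have -> : (r0 - r)%:MP%:M = (r0%:MP%:M - v) + (v - r%:MP%:M) :> mat by mx_ring.
exact: qconeD.
Qed.

(** The supremum need not be attained, hence the margin [e]. *)
Lemma state_le v e : 0 < e -> C (v - (state v - e)%:MP%:M).
Proof.
move=> e0; have [r /= Cr rlt] := sup_adherent e0 (state_has_sup v).
have -> : v - (state v - e)%:MP%:M = (v - r%:MP%:M) + (r - (state v - e))%:MP%:M.
  by mx_ring.
by apply: (qconeD _ qC) => //; apply/qcone_scalar; rewrite subr_ge0 ltW.
Qed.

(** Totality enters here: otherwise state v + e would belong to the set whose supremum is state
    v. *)
Lemma state_ge v e : 0 < e -> C ((state v + e)%:MP%:M - v).
Proof.
move=> e0; have [|] := tC (v - (state v + e)%:MP%:M); last by rewrite opprB.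
move=> /(sup_upper_bound (state_has_sup v)).
by rewrite -/(state v) gerDl leNgt e0.
Qed.

(** Adding the bounds for [l] and for [state v], each with margin e / 2, leaves a scalar in [C], so
    the two numbers differ by at most [e]. *)
Lemma state_unique v l :
  (forall e, 0 < e -> C (v - (l - e)%:MP%:M) /\ C ((l + e)%:MP%:M - v)) ->
  state v = l.
Proof.
move=> vl; apply/eqP; rewrite eq_le; apply/andP; split; apply/ler_addgt0Pr => e e0.
  have e20 : 0 < e / 2 by rewrite divr_gt0.
  rewrite -subr_ge0; apply/qcone_scalar.
  have -> : (l + e - state v)%:MP%:M = ((l + e / 2)%:MP%:M - v)
      + (v - (state v - e / 2)%:MP%:M) :> mat.
    by rewrite {1}(splitr e); mx_ring.
  by apply: (qconeD _ qC); [apply: (vl _ e20).2|apply: state_le].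
have e20 : 0 < e / 2 by rewrite divr_gt0.
rewrite -subr_ge0; apply/qcone_scalar.
have -> : (state v + e - l)%:MP%:M = ((state v + e / 2)%:MP%:M - v)
    + (v - (l - e / 2)%:MP%:M) :> mat.
  by rewrite {1}(splitr e); mx_ring.
by apply: (qconeD _ qC); [apply: state_ge|apply: (vl _ e20).1].
Qed.

Lemma state_ge0 v : C v -> 0 <= state v.
Proof.
move=> Cv; apply: (sup_upper_bound (state_has_sup v)) => /=.
by rewrite mpolyC0 raddf0 subr0.
Qed.

Lemma stateD v w : state (v + w) = state v + state w.
Proof.
apply: state_unique => e e0; have e20 : 0 < e / 2 by rewrite divr_gt0.
split.
  have -> : v + w - (state v + state w - e)%:MP%:M =
      (v - (state v - e / 2)%:MP%:M) + (w - (state w - e / 2)%:MP%:M).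
    by rewrite {1}(splitr e); mx_ring.
  by apply: (qconeD _ qC); apply: state_le.
have -> : (state v + state w + e)%:MP%:M - (v + w) =
    ((state v + e / 2)%:MP%:M - v) + ((state w + e / 2)%:MP%:M - w).
  by rewrite {1}(splitr e); mx_ring.
by apply: (qconeD _ qC); apply: state_ge.
Qed.

Lemma state_scalar r : state (r%:MP%:M) = r.
Proof.
apply: state_unique => e e0; split.
  have -> : r%:MP%:M - (r - e)%:MP%:M = e%:MP%:M :> mat by mx_ring.
  exact/qcone_scalar/ltW.
have -> : (r + e)%:MP%:M - r%:MP%:M = e%:MP%:M :> mat by mx_ring.
exact/qcone_scalar/ltW.
Qed.

Lemma stateB v w : state (v - w) = state v - state w.
Proof. by apply/eqP; rewrite eq_sym subr_eq -stateD subrK. Qed.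

(** If r' - p^2 lies in [C], so does p^2 v + e = p^2 (v + e/r') + (e/r') (r' - p^2), and likewise e
    - p^2 v. *)
Lemma state_squareZ p v : state v = 0 -> state (p ^+ 2 *: v) = 0.
Proof.
move=> v0; have [r Cr] := uC ((p ^+ 2)%:M).
apply: state_unique => e e0.
pose r' := `|r| + 1; have r'0 : 0 < r' by rewrite ltr_wpDl.
have er0 : 0 < e / r' by rewrite divr_gt0.
have er : e%:MP = (e / r')%:MP * r'%:MP :> poly by rewrite -mpolyCM divfK ?gt_eqF.
have Cr' : C ((r'%:MP - p ^+ 2)%:M).
  have -> : (r'%:MP - p ^+ 2)%:M = (r%:MP%:M - (p ^+ 2)%:M) + (r' - r)%:MP%:M :> mat.
    by mx_ring.
  apply: (qconeD _ qC) => //; apply/qcone_scalar.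
  by rewrite subr_ge0; apply: le_trans (ler_norm r) _; rewrite lerDl.
split.
  have -> : p ^+ 2 *: v - (0 - e)%:MP%:M =
      p ^+ 2 *: (v - (state v - e / r')%:MP%:M)
      + (e / r')%:MP *: (r'%:MP - p ^+ 2)%:M.
    by rewrite v0 !sub0r !mpolyCN er; mx_ring.
  apply: (qconeD _ qC); first by apply: (qconeX _ qC); apply: state_le.
  by apply: (qconeZ _ qC); rewrite // ltW.
have -> : (0 + e)%:MP%:M - p ^+ 2 *: v =
    p ^+ 2 *: ((state v + e / r')%:MP%:M - v)
    + (e / r')%:MP *: (r'%:MP - p ^+ 2)%:M.
  by rewrite v0 !add0r er; mx_ring.
apply: (qconeD _ qC); first by apply: (qconeX _ qC); apply: state_ge.
by apply: (qconeZ _ qC); rewrite // ltW.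
Qed.

(** Every polynomial is a difference of squares: p = ((p + 1)/2)^2 - ((p - 1)/2)^2. *)
Lemma state_kerZ p v : state v = 0 -> state (p *: v) = 0.
Proof.
move=> v0; pose c : poly := (2^-1)%:MP.
have cc : c + c = 1.
  by rewrite -mpolyCD -mpolyC1; congr mpolyC; field.
have -> : p *: v = (c * (p + 1)) ^+ 2 *: v - (c * (p - 1)) ^+ 2 *: v.
  rewrite -scalerBl; congr (_ *: _).
  (* [ring] sees [c] as an atom, so the value 1/2 is supplied by inserting the factor 1 as (c +
     c)^2. *)
  by rewrite -[LHS]mul1r -[X in X * p](expr1n _ 2) -[X in X ^+ 2 * p]cc; ring.
by rewrite stateB !state_squareZ // subrr.
Qed.

Lemma state_mulC r v : state (r%:MP *: v) = r * state v.
Proof.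
have -> : r%:MP *: v = r%:MP *: (v - (state v)%:MP%:M) + (r * state v)%:MP%:M.
  by rewrite mpolyCM; mx_ring.
by rewrite stateD state_kerZ ?state_scalar ?add0r // stateB state_scalar subrr.
Qed.

(** The difference v - state v has state 0 and keeps it after multiplication by p, so p v may be
    replaced by (state v) p. *)
Lemma state_mul p v : state (p *: v) = state (p%:M) * state v.
Proof.
have -> : p *: v = p *: (v - (state v)%:MP%:M) + (state v)%:MP *: p%:M by mx_ring.
have v0 : state (v - (state v)%:MP%:M) = 0 by rewrite stateB state_scalar subrr.
by rewrite stateD (state_kerZ _ _ v0) add0r state_mulC mulrC.
Qed.

(** On scalar matrices [state] is a ring homomorphism fixing the constants, hence evaluation at the
    images of the variables. *)
Lemma state_horner p : state p%:M = p.@[fun k => state ('X_k)%:M].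
Proof.
have stM q q' : state (q * q')%:M = state q%:M * state q'%:M.
  by rewrite scalar_mxM mul_scalar_mx state_mul.
have st1 : state (1%:M) = 1 by rewrite -mpolyC1 state_scalar.
elim/mpolyind: p => [|c m p _ _ IH]; first by rewrite -mpolyC0 state_scalar mevalC.
rewrite raddfD /= stateD mevalD IH; congr (_ + _).
rewrite -mul_mpolyC stM state_scalar mevalM mevalC; congr (_ * _).
rewrite mevalX mpolyXE_id; elim/big_ind2: _ => [//|q x q' y e1 e2|i _].
  by rewrite stM e1 e2.
by elim: (m i) => [|k IHk] //; rewrite !exprS stM IHk.
Qed.

End State.

(** * From states to strict positivity *)

Lemma state_exists (K : set mat) : quadratic_cone K -> order_unit K -> K 1%:M ->
  ~ K (- 1%:M) ->
  exists (x : 'I_N -> R) (L : mat -> R),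
    [/\ forall v w, L (v + w) = L v + L w, L 1%:M = 1,
        forall v, K v -> 0 <= L v & forall p v, L (p *: v) = p.@[x] * L v].
Proof.
move=> qK uK K1 nK; have [C [qC KC nC maxC]] := maximal_qcone _ qK nK.
have C1 : C 1%:M by apply: KC.
have uC : order_unit C by move=> v; have [r Kr] := uK v; exists r; apply: KC.
have tC := maximal_total _ qC uC C1 nC maxC.
exists (fun k => state C ('X_k)%:M), (state C); split.
- exact: stateD.
- by rewrite -mpolyC1 state_scalar.
- by move=> v /KC; apply: state_ge0.
- by move=> p v; rewrite state_mul // state_horner.
Qed.

(* If F + r is in K then so is F + r - 1/k for k large, because
   k^2 (F + r - 1/k) = (k - t)^2 (F + r) + 2 k (t F - 1) + (k - t^2 F)
                       + r t (2 k - t);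
   iterating this pushes r below zero. *)
Lemma archimedean_descent (K : set mat) F : quadratic_cone K -> order_unit K ->
  K 1%:M ->
  (exists2 t, sos t & K (t *: F - 1%:M)) -> exists2 e, 0 < e & K (F - e%:MP%:M).
Proof.
move=> qK uK K1 [t st KtF].
have Kc r : 0 <= r -> K r%:MP%:M.
  move=> r0; have -> : r%:MP%:M = r%:MP *: 1%:M :> mat by mx_ring.
  exact: qconeZ.
have [r1 Kr1] := uK (t%:M).
have [r2 Kr2] := uK (t ^+ 2 *: F).
have [r0 Kr0] := uK (- F).
(* One positive constant that dominates both bounds, so that 2 k - t and k - t^2 F lie in [K]. *)
pose k := `|r1| + `|r2| + 1.
have k0 : 0 < k by rewrite ltr_wpDl // addr_ge0.
have Kk1 : K ((k%:MP *+ 2 - t)%:M).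
  have -> : (k%:MP *+ 2 - t)%:M = (r1%:MP%:M - t%:M) + (k *+ 2 - r1)%:MP%:M :> mat.
    by rewrite mpolyCB mpolyCMn; mx_ring.
  apply: (qconeD _ qK) => //; apply: Kc.
  by have := ler_norm r1; have := normr_ge0 r2; have := normr_ge0 r1; rewrite /k; lra.
have Kk2 : K (k%:MP%:M - t ^+ 2 *: F).
  have -> : k%:MP%:M - t ^+ 2 *: F = (r2%:MP%:M - t ^+ 2 *: F) + (k - r2)%:MP%:M.
    by mx_ring.
  apply: (qconeD _ qK) => //; apply: Kc.
  by have := ler_norm r2; have := normr_ge0 r2; have := normr_ge0 r1; rewrite /k; lra.
have ik : k^-1%:MP * k%:MP = 1 :> poly.
  by rewrite -mpolyCM mulVf ?gt_eqF // mpolyC1.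
have step r : 0 <= r -> K (F + r%:MP%:M) -> K (F + (r - k^-1)%:MP%:M).
  move=> r_ge0 KFr.
  have -> : F + (r - k^-1)%:MP%:M = (k^-1 %:MP) ^+ 2 *:
      ((k%:MP - t) ^+ 2 *: (F + r%:MP%:M) + (k *+ 2)%:MP *: (t *: F - 1%:M)
       + (k%:MP%:M - t ^+ 2 *: F) + r%:MP *: (t *: (k%:MP *+ 2 - t)%:M)).
    (* Factors k^-1 k = 1 are inserted by hand, since [ring] does not simplify them; both sides then
       agree as polynomials in k and k^-1. *)
    have -> : F + (r - k^-1)%:MP%:M =
      (k^-1%:MP * k%:MP) ^+ 2 *: F + ((k^-1%:MP * k%:MP) ^+ 2 * r%:MP
         - (k^-1%:MP * k%:MP) * k^-1%:MP)%:M.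
      by rewrite ik; mx_ring.
    by rewrite mpolyCMn; mx_ring.
  apply: (qconeX _ qK); do !apply: (qconeD _ qK) => //.
  - exact: qconeX.
  - by apply: (qconeZ _ qK) => //; rewrite mulrn_wge0 // ltW.
  - by apply: (qconeZ _ qK) => //; apply: qconeS.
(* [j] bounds the number of steps of size 1/k that bring [r] down to 0; from 0, one more step gives
   a strict margin. *)
have down (j : nat) r : r <= j%:R / k -> K (F + r%:MP%:M) ->
    exists2 e, 0 < e & K (F - e%:MP%:M).
  elim: j r => [|j IH] r rj KFr.
    rewrite mul0r in rj; exists k^-1; first by rewrite invr_gt0.
    have -> : F - k^-1%:MP%:M = F + (0 - k^-1)%:MP%:M by mx_ring.
    apply: step => //.
    have -> : F + 0%:MP%:M = (F + r%:MP%:M) + (- r)%:MP%:M by mx_ring.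
    by apply: (qconeD _ qK) => //; apply: Kc; rewrite oppr_ge0.
  have [r_ge0|r_lt0] := leP 0 r; last first.
    by exists (- r); rewrite ?oppr_gt0 // mpolyCN raddfN opprK.
  apply: (IH (r - k^-1)); last exact: step.
  by rewrite lerBlDr -[X in _ + X]mul1r -mulrDl natr1.
apply: (down (Num.trunc (r0 * k)).+1 r0).
  by rewrite ler_pdivlMr // ltW // truncnS_gt.
by rewrite addrC -[F]opprK.
Qed.

Lemma qcone_positivstellensatz (K : set mat) F :
  quadratic_cone K -> order_unit K -> K 1%:M ->
  (forall (x : 'I_N -> R) (L : mat -> R),
    (forall v w, L (v + w) = L v + L w) -> L 1%:M = 1 ->
    (forall v, K v -> 0 <= L v) -> (forall p v, L (p *: v) = p.@[x] * L v) ->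
    0 < L F) ->
  exists2 e, 0 < e & K (F - e%:MP%:M).
Proof.
move=> qK uK K1 posF; apply: archimedean_descent => //.
have K0 := qcone0 _ qK _ K1.
(* Adjoin [- F] to [K]. Either -1 appears, and t F - 1 lies in [K] as the descent requires, or there
   is a state with L F <= 0, against [posF]. *)
have [[c Kc [t st e]]|nK] := pselect (qcone_add K (- F) (- 1%:M)).
  exists t => //; suff -> : t *: F - 1%:M = c by [].
  by rewrite e; mx_ring.
have uK' : order_unit (qcone_add K (- F)).
  by move=> v; have [r Kr] := uK v; exists r; apply: qcone_add_sub.
have K1' := qcone_add_sub K (- F) _ K1.
have [x [L [LD L1 L0 LZ]]] := state_exists _ (qcone_addP _ _ qK) uK' K1' nK.
have := posF x L LD L1 (fun v Kv => L0 v (qcone_add_sub _ _ _ Kv)) LZ.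
have := L0 _ (qcone_add_mem K (- F) K0).
have -> : - F = (-1)%:MP *: F by mx_ring.
by rewrite LZ mevalC mulN1r oppr_ge0 => /le_lt_trans h /h; rewrite ltxx.
Qed.

End QuadraticCones.

(** * Definite matrices *)

Section Definite.
Variable R : realType.

Lemma psd_congr p q (Z : 'M[R]_(p, q)) (G : 'M[R]_q) :
  psd G -> psd (Z *m G *m Z^T).
Proof.
move=> [sG pG]; split; first by rewrite !trmx_mul trmxK sG mulmxA.
move=> v; have := pG (Z^T *m v).
by rewrite trmx_mul trmxK !mulmxA.
Qed.

Lemma psd_block p q (G : 'M[R]_p) (H : 'M[R]_q) :
  psd G -> psd H -> psd (block_mx G 0 0 H).
Proof.
move=> [sG pG] [sH pH]; split; first by rewrite tr_block_mx !trmx0 sG sH.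
move=> v; rewrite -[v]vsubmxK tr_col_mx mul_row_block !mulmx0 addr0 add0r.
by rewrite mul_row_col mxE addr_ge0.
Qed.

Lemma psd1 p : psd (1%:M : 'M[R]_p).
Proof.
split; first exact: trmx1.
move=> v; rewrite mulmx1 mxE sumr_ge0 // => i _.
by rewrite mxE -expr2 sqr_ge0.
Qed.

Lemma posdef_psd p (C : 'M[R]_p) : posdef C -> psd C.
Proof.
move=> [sC pC]; split=> // v; have [->|/pC/ltW//] := eqVneq v 0.
by rewrite mulmx0 mxE.
Qed.

Lemma posdef_unit p (C : 'M[R]_p) : posdef C -> C \in unitmx.
Proof.
move=> [_ pC]; rewrite unitmxE unitfE; apply/det0P => -[v v0 vC].
have := pC v^T; rewrite trmxK vC mul0mx mxE ltxx => h.
suff : false by []; apply: h.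
by rewrite -trmx0 (inj_eq trmx_inj).
Qed.

(** The inverse is the congruence C^-1 C (C^-1)^T of C. *)
Lemma psd_inv p (C : 'M[R]_p) : posdef C -> psd (invmx C).
Proof.
move=> pC; have := psd_congr _ _ (invmx C) _ (posdef_psd _ _ pC).
by rewrite mulVmx ?posdef_unit // mul1mx trmx_inv pC.1.
Qed.

Lemma psd_posdefD p (C : 'M[R]_p) e : psd C -> 0 < e -> posdef (C + e%:M).
Proof.
move=> [sC pC] e0; split; first by rewrite raddfD /= sC tr_scalar_mx.
move=> v v0; rewrite mulmxDr mulmxDl mxE ltr_wpDl //.
rewrite mul_mx_scalar -scalemxAl mxE mulr_gt0 //.
have [/matrix0Pn[i [j vij]]] := v0.
rewrite mxE (bigD1 i) //= ltr_pwDl //.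
  by rewrite mxE -expr2 exprn_even_gt0 //= -(ord1 j).
by apply: sumr_ge0 => k _; rewrite mxE -expr2 sqr_ge0.
Qed.

Lemma psdD p (A B : 'M[R]_p) : psd A -> psd B -> psd (A + B).
Proof.
move=> [sA pA] [sB pB]; split; first by rewrite raddfD /= sA sB.
by move=> v; rewrite mulmxDr mulmxDl mxE addr_ge0.
Qed.

Lemma psdZ p r (A : 'M[R]_p) : 0 <= r -> psd A -> psd (r *: A).
Proof.
move=> r0 [sA pA]; split; first by rewrite linearZ /= sA.
by move=> v; rewrite -scalemxAr -scalemxAl mxE mulr_ge0.
Qed.

Lemma psd0 p : psd (0 : 'M[R]_p).
Proof. by split=> [|v]; rewrite ?trmx0 // mulmx0 mul0mx mxE. Qed.

End Definite.

(** * The Positivstellensatz *)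

Section MatrixPutinar.
Variables (R : realType) (N s : nat).
Local Notation poly := {mpoly R[N]}.
Local Notation mat := 'M[{mpoly R[N]}]_s.

Lemma cst_mxM p q r (A : 'M[R]_(p, q)) (B : 'M[R]_(q, r)) :
  cst_mx N (A *m B) = cst_mx N A *m cst_mx N B.
Proof. exact: map_mxM. Qed.

Lemma cst_mx_tr p q (A : 'M[R]_(p, q)) : (cst_mx N A)^T = cst_mx N A^T.
Proof. by rewrite /cst_mx map_trmx. Qed.

Lemma trmxZ p q (a : poly) (A : 'M[poly]_(p, q)) : (a *: A)^T = a *: A^T.
Proof. by apply/matrixP=> i j; rewrite !mxE. Qed.

(* Equivalent to [sos_mx], but closure under sums is immediate in this form:
   concatenate the [W]'s and put the [G]'s in a block diagonal matrix. *)
Definition gram (P : mat) : Prop :=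
  exists q (W : 'M[poly]_(s, q)) (G : 'M[R]_q),
    psd G /\ P = W *m cst_mx N G *m W^T.

(** Let [w] list all entries of [W]. A 0/1 matrix [Z] selects them back, W = (w ⊗ I)^T Z, so Z G Z^T
    is a Gram matrix for [w]. *)
Lemma gram_sos_mx P : gram P -> sos_mx P.
Proof.
move=> [q [W [G [pG ->]]]].
pose w : 'cV[poly]_(s * q) := (mxvec W)^T.
pose Z : 'M[R]_(s * q * s, q) := \matrix_(r, j)
  let kb := enum_val (cast_ord (esym (mxvec_cast (s * q) s)) r) in
  let al := enum_val (cast_ord (esym (mxvec_cast s q)) kb.1) in
  ((al.1 == kb.2) && (al.2 == j))%:R.
have ZE a l b j : Z (mxvec_index (mxvec_index a l) b) j
    = ((a == b) && (l == j))%:R.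
  by rewrite mxE /mxvec_index !cast_ordK !enum_rankK /= cast_ordK enum_rankK.
have WE : (kron_id s w)^T *m cst_mx N Z = W.
  apply/matrixP=> i j; rewrite mxE.
  (* Only the row ((i, j), i) contributes, and its term is the entry (i, j) of [W]. *)
  rewrite (bigD1 (mxvec_index (mxvec_index i j) i)) //= big1 ?addr0.
    by rewrite [X in X * _]mxE kron_idE [X in _ * X]mxE ZE !mxE mxvecE !eqxx mulr1.
  move=> r; case/mxvec_indexP: r => k b; case/mxvec_indexP: k => a l ne.
  rewrite [X in X * _]mxE kron_idE [X in _ * X]mxE ZE.
  have [bi|] := eqVneq b i; last by rewrite mulr0n mul0r.
  have [ab|] := eqVneq a b; last by rewrite mulr0.
  have [lj|] := eqVneq l j; last by rewrite mulr0.
  by rewrite ab bi lj eqxx in ne.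
exists (s * q)%N, w, (Z *m G *m Z^T); split; first exact: psd_congr.
rewrite -{2}WE trmx_mul trmxK cst_mx_tr -{1}WE !cst_mxM !mulmxA.
by [].
Qed.

Lemma gram_qcone : quadratic_cone _ _ _ gram.
Proof.
split=> [v w|p v].
  move=> [q [W [G [pG ->]]]] [q' [W' [G' [pG' ->]]]].
  exists (q + q')%N, (row_mx W W'), (block_mx G 0 0 G'); split.
    exact: psd_block.
  rewrite /cst_mx map_block_mx !map_mx0 mul_row_block !mulmx0 addr0 add0r.
  by rewrite tr_row_mx mul_row_col.
move=> [q [W [G [pG ->]]]]; exists q, (p *: W), G; split => //.
by rewrite trmxZ -!scalemxAl -scalemxAr scalerA expr2.
Qed.

Lemma gram_outer q (W : 'M[poly]_(s, q)) : gram (W *m W^T).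
Proof.
exists q, W, 1%:M; split; first exact: psd1.
by rewrite /cst_mx map_mx1 mulmx1.
Qed.

Lemma gram_cst (G : 'M[R]_s) : psd G -> gram (cst_mx N G).
Proof. by move=> pG; exists s, 1%:M, G; rewrite trmx1 mulmx1 mul1mx. Qed.

Lemma gram0 : gram 0.
Proof. by have := gram_outer 1 0; rewrite mul0mx. Qed.

(** * The quadratic module of the described set *)

Variables (I J : finType) (g : I -> poly) (h : J -> poly).

(** The representations of [Sigma_le] without degree bounds and without the term in [e], in terms of
    [gram]. *)
Definition qmod (P : mat) : Prop :=
  exists (sigma0 : mat) (sigma : I -> mat) (phi : J -> mat),
    [/\ gram sigma0, forall i, gram (sigma i), forall j, (phi j)^T = phi j &
        P = sigma0 + \sum_i g i *: sigma i + \sum_j h j *: phi j].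

Lemma qmod_qcone : quadratic_cone _ _ _ qmod.
Proof.
have [gD gX] := gram_qcone.
split=> [v w|p v].
  move=> [s0 [s1 [f [gs0 gs1 sf ->]]]] [s0' [s1' [f' [gs0' gs1' sf' ->]]]].
  exists (s0 + s0'), (fun i => s1 i + s1' i), (fun j => f j + f' j); split.
  - exact: gD.
  - by move=> i; apply: gD.
  - by move=> j; rewrite raddfD /= sf sf'.
  - rewrite (eq_bigr _ (fun i _ => scalerDr (g i) (s1 i) (s1' i))) big_split /=.
    rewrite (eq_bigr _ (fun j _ => scalerDr (h j) (f j) (f' j))) big_split /=.
    by rewrite addrACA; congr (_ + _); rewrite addrACA.
move=> [s0 [s1 [f [gs0 gs1 sf ->]]]].
exists (p ^+ 2 *: s0), (fun i => p ^+ 2 *: s1 i), (fun j => p ^+ 2 *: f j); split.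
- exact: gX.
- by move=> i; apply: gX.
- by move=> j; rewrite trmxZ sf.
- rewrite 2!scalerDr; congr (_ + _ + _); rewrite scaler_sumr;
  apply: eq_bigr => i _; by rewrite [LHS]scalerA [RHS]scalerA [X in X *: _]mulrC.
Qed.

Lemma qmodD P Q : qmod P -> qmod Q -> qmod (P + Q).
Proof. exact: qmod_qcone.1. Qed.

Lemma qmodX p P : qmod P -> qmod (p ^+ 2 *: P).
Proof. exact: qmod_qcone.2. Qed.

Lemma qmod_gram P : gram P -> qmod P.
Proof.
move=> gP; exists P, (fun=> 0), (fun=> 0); split => //.
- by move=> _; apply: gram0.
- by move=> _; rewrite trmx0.
- by rewrite !big1 ?addr0 // => *; rewrite scaler0.
Qed.

Lemma qmod_ineq i P : gram P -> qmod (g i *: P).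
Proof.
move=> gP; exists 0, (fun k => if k == i then P else 0), (fun=> 0); split => //.
- exact: gram0.
- by move=> k; case: eqP => // _; apply: gram0.
- by move=> _; rewrite trmx0.
- rewrite (bigD1 i) //= eqxx !big1 ?addr0 ?add0r // => [*|k /negPf ->].
    by rewrite scaler0.
  by rewrite scaler0.
Qed.

Lemma qmod_eq j P : P^T = P -> qmod (h j *: P).
Proof.
move=> sP; exists 0, (fun=> 0), (fun k => if k == j then P else 0); split => //.
- exact: gram0.
- by move=> k; apply: gram0.
- by move=> k; case: eqP => // _; rewrite trmx0.
- rewrite [X in _ + X](bigD1 j) //= eqxx !big1 ?addr0 ?add0r // => [k /negPf ->|*].
    by rewrite scaler0.
  by rewrite scaler0.
Qed.

(* Extends the quadratic module from symmetric matrices to the module of all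
   matrices; skew-symmetric matrices become zero for the induced preorder. *)
Definition sym_qmod : set mat := [set P | qmod (P + P^T)]%classic.

Lemma sym_qmod_qcone : quadratic_cone _ _ _ sym_qmod.
Proof.
split=> [v w qv qw|p v qv]; rewrite /sym_qmod /=.
  by rewrite raddfD /= addrACA; apply: qmod_qcone.1.
by rewrite trmxZ -scalerDr; apply: qmod_qcone.2.
Qed.

Lemma sym_qmod_sub P : P^T = P -> qmod P -> sym_qmod P.
Proof. by move=> sP qP; rewrite /sym_qmod /= sP; apply: qmod_qcone.1. Qed.

Lemma sym_qmod_inv P : P^T = P -> sym_qmod P -> qmod P.
Proof.
rewrite /sym_qmod /= => sP; rewrite sP => qP.
have -> : P = (2^-1 : R)%:MP *: (P + P).
  rewrite scalerDr -scalerDl -mpolyCD.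
  have -> : 2^-1 + 2^-1 = 1 :> R by field.
  by rewrite mpolyC1 scale1r.
by apply: (qconeZ _ _ _ _ qmod_qcone); rewrite // invr_ge0.
Qed.

(** * Boundedness and the matrix Positivstellensatz *)

Section Archimedean.
Hypothesis arch : archimedean g h.

Local Notation E a := (delta_mx a a : mat).

Lemma gram_E a : gram (E a).
Proof.
have := gram_outer 1 (delta_mx a 0).
by rewrite trmx_delta mul_delta_mx.
Qed.

Lemma qmod_cE a r : 0 <= r -> qmod (r%:MP *: E a).
Proof.
by move=> r0; apply: (qconeZ _ _ _ _ qmod_qcone) => //; apply/qmod_gram/gram_E.
Qed.

Lemma qmod_arch a : exists r, qmod ((r%:MP - \sum_(k < N) 'X_k ^+ 2) *: E a).
Proof.
have [r _ [s0 [s1 [f [ss0 ss1 e]]]]] := arch; exists r; rewrite e.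
exists (s0 *: E a), (fun i => s1 i *: E a), (fun j => f j *: E a); split.
- exact: (qconeS _ _ _ _ gram_qcone _ _ ss0 (gram_E a)).
- by move=> i; apply: (qconeS _ _ _ _ gram_qcone _ _ (ss1 i) (gram_E a)).
- by move=> j; rewrite trmxZ trmx_delta.
- rewrite 2!scalerDl; congr (_ + _ + _); rewrite scaler_suml;
  apply: eq_bigr => i _; by rewrite [RHS]scalerA [X in X *: _]mulrC.
Qed.

(** The polynomials with bounded square form a ring, by 2r + 2r' - (q + q')^2 = (q - q')^2 + 2(r -
    q^2) + 2(r' - q'^2) and r r' - q^2 q'^2 = r'(r - q^2) + q^2 (r' - q'^2). It contains the
    constants and, by the Archimedean identity, the variables. *)
Lemma qmod_bounded a (p : poly) :
  exists2 r, 0 <= r & qmod ((r%:MP - p ^+ 2) *: E a).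
Proof.
pose B (p : poly) := exists2 r, 0 <= r & qmod ((r%:MP - p ^+ 2) *: E a).
have BD q q' : B q -> B q' -> B (q + q').
  move=> [r r0 qr] [r' r'0 qr']; exists (r *+ 2 + r' *+ 2).
    by rewrite addr_ge0 // mulrn_wge0.
  have -> : ((r *+ 2 + r' *+ 2)%:MP - (q + q') ^+ 2) *: E a =
    (q - q') ^+ 2 *: E a + (((r%:MP - q ^+ 2) *: E a + (r%:MP - q ^+ 2) *: E a) +
      ((r'%:MP - q' ^+ 2) *: E a + (r'%:MP - q' ^+ 2) *: E a)).
    by rewrite -!scalerDl mpolyCD !mpolyCMn; congr (_ *: _); ring.
  by apply: qmodD; [apply/qmodX/qmod_gram/gram_E|apply: qmodD; apply: qmodD].
have BM q q' : B q -> B q' -> B (q * q').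
  move=> [r r0 qr] [r' r'0 qr']; exists (r * r'); first by rewrite mulr_ge0.
  have -> : ((r * r')%:MP - (q * q') ^+ 2) *: E a =
    r'%:MP *: ((r%:MP - q ^+ 2) *: E a) + q ^+ 2 *: ((r'%:MP - q' ^+ 2) *: E a).
    by rewrite !scalerA -!scalerDl mpolyCM; congr (_ *: _); ring.
  by apply: qmodD; [apply: (qconeZ _ _ _ _ qmod_qcone)|apply: qmodX].
have BC c : B c%:MP.
  exists (c ^+ 2); first exact: sqr_ge0.
  rewrite rmorphXn subrr scale0r; exact/qmod_gram/gram0.
have BX k : B 'X_k.
  have [r qr] := qmod_arch a; exists `|r| => //.
  have -> : (`|r|%:MP - 'X_k ^+ 2) *: E a = (`|r| - r)%:MP *: E a +
      ((r%:MP - \sum_(i < N) 'X_i ^+ 2) *: E a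
       + (\sum_(i < N | i != k) 'X_i ^+ 2) *: E a).
    rewrite -!scalerDl; congr (_ *: _).
    by rewrite [\sum_(i < N) _](bigD1 k) //= mpolyCB; ring.
  apply: qmodD; first by apply: qmod_cE; rewrite subr_ge0 ler_norm.
  apply: qmodD => //; apply: qmod_gram; rewrite scaler_suml.
  elim/big_ind: _ => [|v w|i _]; [exact: gram0|exact: gram_qcone.1|].
  by apply: gram_qcone.2; apply: gram_E.
rewrite -/(B p); elim/mpolyind: p => [|c m p _ _ IH].
  by rewrite -mpolyC0; apply: (BC _).
apply: BD => //; rewrite -mul_mpolyC; apply: (BM _ _); first exact: BC.
rewrite mpolyXE_id; elim/big_ind: _ => [|q q'|i _]; [exact: (BC 1)|exact: BM|].
elim: (m i) => [|k IHk]; first exact: (BC 1).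
by rewrite exprS; apply: (BM _ _).
Qed.

(** Entries are bounded one at a time. For u = p e_i - e_j, the square u u^T equals p^2 E_i - p
    (E_ij + E_ji) + E_j; the bound on p^2 at E_i and the projections 1 - E_i, 1 - E_j complete it to
    2 (r + 1) - p (E_ij + E_ji). *)
Lemma sym_qmod_order_unit : order_unit _ _ _ sym_qmod.
Proof.
move=> Q; rewrite (matrix_sum_delta Q).
elim/big_rec: _ => [|i Q1 _ [r1 qr1]].
  exists 0; rewrite mpolyC0 raddf0 subr0; apply: sym_qmod_sub.
    exact: trmx0.
  exact/qmod_gram/gram0.
elim/big_rec: _ => [|j Q2 _ [r2 qr2]]; first by exists r1; rewrite add0r.
have [r r0 qr] := qmod_bounded i (Q i j).
set p := Q i j in qr *; exists ((r + 1) + r2).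
have -> : (r + 1 + r2)%:MP%:M - (p *: delta_mx i j + Q2 + Q1) =
  ((r + 1)%:MP%:M - p *: delta_mx i j) + (r2%:MP%:M - (Q2 + Q1)) by mx_ring.
apply: sym_qmod_qcone.1 => //; rewrite /sym_qmod /=.
have -> : (r + 1)%:MP%:M - p *: delta_mx i j + ((r + 1)%:MP%:M - p *: delta_mx i j)^T
   = (p *: delta_mx i 0 - delta_mx j 0 : 'cV_s) *m (p *: delta_mx i 0 - delta_mx j 0 : 'cV_s)^T
   + ((r%:MP - p ^+ 2) *: E i + (r%:MP *: ((1%:M - E i) *m (1%:M - E i)^T)
   + ((1%:M - E j) *m (1%:M - E j)^T + (r + 1)%:MP *: (1%:M *m 1%:M^T)))).
  rewrite !raddfB /= !trmxZ !trmx_delta tr_scalar_mx trmx1.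
  rewrite !(mulmxBl, mulmxBr) -!scalemxAl -!scalemxAr !mulmx1 !mul1mx.
  rewrite !mul_delta_mx.
  move: (delta_mx i j) (delta_mx j i) (E i) (E j) => Eij Eji Ei Ej.
  by rewrite mpolyCD mpolyC1; mx_ring.
have r10 : 0 <= r + 1 by rewrite addr_ge0.
apply: qmodD; [exact/qmod_gram/gram_outer|apply: qmodD; [exact: qr|]].
apply: qmodD; first exact/(qconeZ _ _ _ _ qmod_qcone _ _ r0)/qmod_gram/gram_outer.
apply: qmodD; first exact/qmod_gram/gram_outer.
exact/(qconeZ _ _ _ _ qmod_qcone _ _ r10)/qmod_gram/gram_outer.
Qed.

(* With D = C^-1, the matrix (C - e) D (C - e) = C - 2 e + e^2 D is positive
   semidefinite, so L C >= 2 e - e^2 L D, which is positive for small e > 0. *)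
Lemma posdef_state (L : mat -> R) (C : 'M[R]_s) :
  (forall v w, L (v + w) = L v + L w) -> L 1%:M = 1 ->
  (forall G, psd G -> 0 <= L (cst_mx N G)) ->
  (forall r v, L (r%:MP *: v) = r * L v) ->
  posdef C -> 0 < L (cst_mx N C).
Proof.
move=> LD L1 Lpsd LZ pC.
have l0 := Lpsd _ (psd_inv _ _ _ pC); set l := L _ in l0.
(* This choice gives e l <= 1, hence L C >= 2 e - e^2 l >= e > 0. *)
pose e := (l + 1)^-1; have e0 : 0 < e by rewrite invr_gt0 ltr_wpDl.
have := Lpsd _ (psd_congr _ _ _ (C - e%:M) _ (psd_inv _ _ _ pC)).
have -> : (C - e%:M) *m invmx C *m (C - e%:M)^T
    = C + (- (e *+ 2) *: 1%:M + e ^+ 2 *: invmx C).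
  rewrite raddfB /= tr_scalar_mx pC.1 !(mulmxBl, mulmxBr).
  rewrite mulmxV ?posdef_unit // mul1mx !mul_scalar_mx !mul_mx_scalar.
  rewrite -scalemxAl mulVmx ?posdef_unit // scalerA.
  by mx_ring.
rewrite /cst_mx !map_mxD !map_mxZ map_mx1 !LD !LZ L1 -/(cst_mx N C) -/l mulr1.
have el : e * l <= 1.
  by rewrite /e mulrC ler_pdivrMr ?ltr_wpDl // mul1r lerDl.
have : e * (e * l) <= e by rewrite -[leRHS]mulr1 ler_pM2l.
by rewrite expr2 -mulrA mulr2n; lra.
Qed.

Lemma matrix_positivstellensatz (P : mat) : P^T = P ->
  (forall x, semialg g h x -> posdef (map_mx (meval x) P)) ->
  exists2 e, 0 < e & qmod (P - e%:MP%:M).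
Proof.
move=> sP posP.
have q1 : sym_qmod 1%:M.
  apply: sym_qmod_sub; first exact: trmx1.
  by have := qmod_gram _ (gram_outer s 1%:M); rewrite trmx1 mulmx1.
have [|e e0 qe] := qcone_positivstellensatz _ _ _ _ P sym_qmod_qcone
    sym_qmod_order_unit q1; last first.
  exists e => //; apply: sym_qmod_inv => //.
  by rewrite raddfB /= sP tr_scalar_mx.
move=> x L LD L1 L0 LZ.
have L00 : L 0 = 0 by rewrite -(scale0r 0) LZ meval0 mul0r.
have sg : semialg g h x.
  (* The value g_i(x) is L (g_i 1). For an equality both h_j 1 and -h_j 1 lie in the module, so
     h_j(x) has both signs. *)
  split=> [i|j].
    rewrite -[leRHS]mulr1 -L1 -LZ; apply: L0; apply: sym_qmod_sub.
      by rewrite trmxZ trmx1.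
    by apply: qmod_ineq; have := gram_outer s 1%:M; rewrite trmx1 mulmx1.
  apply/eqP; rewrite eq_le -oppr_ge0; apply/andP; split.
    rewrite -mulN1r -(mevalC x (-1)) -[leRHS]mulr1 -mulrA -L1 -!LZ scalerA.
    rewrite mulrC -scalerA; apply: L0; apply: sym_qmod_sub.
      by rewrite !trmxZ trmx1.
    by apply: qmod_eq; rewrite trmxZ trmx1.
  rewrite -[leRHS]mulr1 -L1 -LZ; apply: L0; apply: sym_qmod_sub.
    by rewrite trmxZ trmx1.
  by apply: qmod_eq; rewrite trmx1.
(* Expand in the matrix units: L (p E_ij) = p(x) L E_ij, so [L] sees only the values of the entries
   at [x]. *)
have -> : L P = L (cst_mx N (map_mx (meval x) P)).
  rewrite [in LHS](matrix_sum_delta P) [in RHS](matrix_sum_delta (cst_mx _ _)).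
  rewrite !(big_morph L LD L00); apply: eq_bigr => i _.
  rewrite !(big_morph L LD L00); apply: eq_bigr => j _.
  rewrite !LZ; congr (_ * _).
  by rewrite !mxE; exact/esym/mevalC.
apply: posdef_state => //.
- move=> G pG; apply: L0; apply: sym_qmod_sub.
    by rewrite cst_mx_tr pG.1.
  exact/qmod_gram/gram_cst.
- by move=> r v; rewrite LZ mevalC.
- exact: posP.
Qed.

(** One certificate without degree bound serves for every [d] that bounds the sizes of its finitely
    many terms. *)
Lemma Sigma_le_of_posdef (P : mat) : P^T = P ->
  (forall x, semialg g h x -> posdef (map_mx (meval x) P)) ->
  exists d0 : nat, forall d, (d0 <= d)%N -> Sigma_le g h d P.
Proof.
move=> sP posP.
have [e e0 [s0 [s1 [f [gs0 gs1 sf eP]]]]] := matrix_positivstellensatz _ sP posP.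
pose deg (Q : mat) := (\max_i \max_j msize (Q i j))%N.
have degP d (Q : mat) : (deg Q <= d)%N -> mxdeg_le (2 * d) Q.
  move=> Qd i j; apply: leq_trans (leqW (leq_pmull d _)) => //.
  apply: leq_trans Qd; apply: leq_trans (leq_bigmax i).
  exact: (@leq_bigmax _ (fun j => msize (Q i j))).
exists (maxn (deg s0) (maxn (\max_i deg (g i *: s1 i)) (\max_j deg (h j *: f j)))).
move=> d; rewrite !geq_max => /and3P[d1 d2 d3].
exists s0, s1, f, e; split; last by rewrite -eP /cst_mx map_scalar_mx /= subrK.
  by split=> // [|i]; apply: gram_sos_mx.
split=> [|i|j]; apply: degP => //.
  exact: leq_trans (leq_bigmax i) d2.
exact: leq_trans (leq_bigmax j) d3.
Qed.

End Archimedean.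

(** * Evaluation of certificates *)

Lemma sos_mx_psd (P : mat) x : sos_mx P -> psd (map_mx (meval x) P).
Proof.
move=> [q [w [G [pG ->]]]].
have -> : map_mx (meval x) ((kron_id s w)^T *m cst_mx N G *m kron_id s w)
   = (map_mx (meval x) (kron_id s w))^T *m G *m map_mx (meval x) (kron_id s w).
  rewrite !map_mxM; congr (_ *m _ *m _).
    by apply/matrixP=> i j; rewrite !mxE.
  by apply/matrixP=> i j; rewrite !mxE; apply: mevalC.
rewrite -[X in _ *m X]trmxK; exact: psd_congr.
Qed.

Lemma Sigma_le_posdef d (P : mat) x :
  Sigma_le g h d P -> semialg g h x -> posdef (map_mx (meval x) P).
Proof.
move=> [s0 [s1 [f [e [[ss0 ss1 _ e0] _ ->]]]]] [g0 h0].
rewrite !map_mxD !map_mx_sum [X in _ + X + _]big1 ?addr0; last first.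
  by move=> j _; rewrite map_mxZ /= h0 scale0r.
have -> : map_mx (meval x) (cst_mx N (e%:M : 'M_s)) = e%:M.
  by apply/matrixP=> i j; rewrite !mxE mevalC.
apply: psd_posdefD => //; apply: psdD; first exact: sos_mx_psd.
elim/big_ind: _ => [|A B|i _]; [exact: psd0|exact: psdD|].
by rewrite map_mxZ; apply: psdZ; [exact: g0|exact: sos_mx_psd].
Qed.

End MatrixPutinar.

(** * Quadratic stabilization *)

Section Stability.
Variables (R : realType) (n m T : nat).
Variables (Y : 'M[R]_n) (S : 'M[R]_(m, n)).
Local Notation K := (nvars n m T).
Local Notation stab_poly :=
  (stab_mx (cst_mx K Y) (cst_mx K S) (varA R n m T) (varB R n m T)).

Lemma stab_poly_sym : Y^T = Y -> stab_poly^T = stab_poly.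
Proof. by move=> sY; rewrite /stab_mx tr_block_mx trmxK cst_mx_tr sY. Qed.

Lemma meval_stab_poly (A : 'M[R]_n) (B : 'M[R]_(n, m)) (Dx : 'M[R]_(n, T)) :
  map_mx (meval (Defs.point A B Dx)) stab_poly = stab_mx Y S A B.
Proof.
rewrite /stab_mx map_block_mx -map_trmx !(map_mxD, map_mxM).
by rewrite meval_varA meval_varB !meval_cst_mx.
Qed.

(** The Positivstellensatz asks for positivity at arbitrary assignments of the variables, whereas
    [stab_cert] speaks of matrices. *)
Lemma point_surj (x : 'I_K -> R) : 
  exists (A : 'M[R]_n) (B : 'M[R]_(n, m)) (Dx : 'M[R]_(n, T)), Defs.point A B Dx = x.
Proof.
pose v : 'rV[R]_K := \row_k x k.
exists (vec_mx (lsubmx (lsubmx v))), (vec_mx (rsubmx (lsubmx v))), (vec_mx (rsubmx v)).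
by rewrite /Defs.point !vec_mxK !hsubmxK; apply/funext => k; rewrite mxE.
Qed.

End Stability.

Theorem theorem3p3 (R : realType) (n m T : nat)
    (hn : (1 <= n)%N) (hm : (1 <= m)%N) (hT : (2 <= T)%N)
    (eps : R) (heps : 0 <= eps)
    (X : 'M[R]_(n, T)) (U : 'M[R]_(m, T.-1))
    (harch : Pbar_archimedean eps X U) :
  (forall (d : nat) (Y : 'M[R]_n) (S : 'M[R]_(m, n)),
      feasible eps X U d Y S ->
      stab_cert eps X U Y S /\ quad_stabilizes eps X U (S *m invmx Y)) /\
  ((exists (Y : 'M[R]_n) (S : 'M[R]_(m, n)),
      posdef Y /\ stab_cert eps X U Y S) ->
   exists d0 : nat, forall d : nat, (d0 <= d)%N ->
     exists (Y : 'M[R]_n) (S : 'M[R]_(m, n)), feasible eps X U d Y S).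
Proof.
split=> [d Y S [pY cert]|[Y [S [pY stab]]]].
  have stab : stab_cert eps X U Y S.
    move=> A B [Dx /(PbarE _ _ _ _ _ heps) sPx].
    rewrite -(meval_stab_poly _ _ _ T _ _ A B Dx).
    exact: Sigma_le_posdef cert sPx.
  by split=> //; exists Y, S.
have [|x sx|d0 hd0] := Sigma_le_of_posdef _ _ _ _ _ _ _ harch
    (stab_mx (cst_mx (nvars n m T) Y) (cst_mx (nvars n m T) S)
      (varA R n m T) (varB R n m T)).
- exact/stab_poly_sym/pY.1.
(* The evaluated matrix depends on (A, B) alone, so positivity over the projection gives positivity
   on the whole consistency set. *)
- have [A [B [Dx eqx]]] := point_surj _ _ _ _ x; rewrite -eqx in sx *.
  rewrite meval_stab_poly; apply: stab; exists Dx.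
  exact/(PbarE _ _ _ _ _ heps).
- by exists d0 => d /hd0 cert; exists Y, S.
Qed.
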